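(* Let $G$ be a finite graph with a self-loop on every vertex, and let $v$ be a vertex of $G$ of degree $d=d(v)$, where the self-loop at $v$ is counted once (so $d-1$ is the number of neighbours of $v$ other than $v$ itself). Then $$R(G,v)=\frac{C(G)}{C(G-\{v\})} \leq 1 + \frac{d^2-d}{2}.$$
   Context: For a finite graph $H$ (undirected, with a self-loop on every vertex and no multiple edges), $C(H)$ denotes the number of vertex-disjoint directed cycle covers of $H$, where cycles of every positive length are allowed: a cycle of length 1 is a single vertex using its loop, and a cycle of length 2 consists of two adjacent vertices using the edge between them in both directions. Equivalently, $C(H)$ is the number of permutations $\sigma$ of the vertex set of $H$ such that for every vertex $u$, either $\sigma(u)=u$ or $\sigma(u)$ is adjacent to $u$. The empty graph has $C=1$. $G-\{v\}$ denotes the graph obtained from $G$ by deleting $v$ and its incident edges, and $R(G,v)=C(G)/C(G-\{v\})$. *)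

(* Defs.v *)
From mathcomp Require Import all_boot all_order all_algebra all_fingroup.
Set Implicit Arguments. Unset Strict Implicit. Unset Printing Implicit Defensive.

(* A finite graph with a self-loop at every vertex: vertex set = finType T,
   adjacency between distinct vertices given by a symmetric relation e
   (the value of e on the diagonal is irrelevant: every vertex carries a loop). *)

Definition cycle_cover (T : finType) (e : rel T) (s : {perm T}) : bool :=
  [forall u, (s u == u) || e u (s u)].

Definition C (T : finType) (e : rel T) : nat := #|[set s : {perm T} | cycle_cover e s]|.

Definition del_vertex (T : finType) (v : T) : finType := {x : T | x != v}.

Definition del_rel (T : finType) (e : rel T) (v : T) : rel (del_vertex v) :=
  fun x y => e (val x) (val y).

(* degree of v, with the self-loop counted once *)
Definition deg (T : finType) (e : rel T) (v : T) : nat :=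
  #|[set u | (u != v) && e v u]|.+1.
Arguments del_rel {T} e v.

(* Main.v *)
Require Import Defs.
From mathcomp Require Import all_boot all_order all_algebra all_fingroup.
From mathcomp Require Import lra.
Import GRing.Theory Num.Theory.
Local Open Scope ring_scope.

(* Classify the covers s of G by the predecessor a and the successor b of v.
   Those with a = b = v are the covers of H = G - v; those with a = b <> v inject
   into them by splitting the 2-cycle (a v).  For a <> b, let Q_ab be their set.
   A pair (x, y) in Q_ab x Q_ba, seen as two matchings of the bipartite double
   cover, is turned into a pair of covers of H, the first fixing b and the second
   not, by exchanging x and y along one alternating path and adding loops at a
   and b.  This is injective, so with |Q_ab| = |Q_ba| (inversion) and AM-GM,
   |Q_ab|^2 <= F N <= ((F + N) / 2)^2 where F + N = C(H), that is
   2 |Q_ab| <= C(H).  Summing over the d - 1 neighbours a, b of v gives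
   C(G) <= C(H) (1 + (d - 1) + (d - 1)(d - 2) / 2). *)

(** * Exchange of two permutations along an alternating path *)

(** Products apply their left factor first, so [w] sends [u] to the point that [x] maps to [y u]:
    its orbits are the alternating cycles of [x] and [y] in the double cover. Multiplying by a
    restriction of [w] makes both components permutations by construction. *)
Definition swap_on_orbit {T : finType} (p : T) (xy : {perm T} * {perm T}) :
    {perm T} * {perm T} :=
  let w := (xy.2 * xy.1^-1)%g in
  let r := restr_perm (porbit w p) w in
  (r * xy.1, r^-1 * xy.2)%g.

Lemma porbit_closed (T : finType) (w : {perm T}) (p u : T) :
  (w u \in porbit w p) = (u \in porbit w p).
Proof.
by rewrite -!eq_porbit_mem -[w u]/((w ^+ 1)%g u) porbit_perm.
Qed.

Lemma swap_on_orbitE (T : finType) (p : T) (x y : {perm T}) (u : T) :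
  let S := porbit (y * x^-1)%g p in
  let xy' := swap_on_orbit p (x, y) in
  (xy'.1 u = if u \in S then y u else x u) /\
  (xy'.2 u = if u \in S then x u else y u).
Proof.
set w := (y * x^-1)%g => S; rewrite /swap_on_orbit /= -/w.
have wN : w \in 'N(S | 'P)%g by apply/astabsP => t /=; exact: porbit_closed.
split; rewrite permM; last first.
  case: ifP => uS.
    have wu : (w^-1)%g u \in S by rewrite -porbit_closed permKV.
    have <- : restr_perm S w ((w^-1)%g u) = u by rewrite restr_permE ?permKV.
    by rewrite permK restr_permE // permKV invMg invgK permM permKV.
  have ru : restr_perm S w u = u by apply: (out_perm (restr_perm_on _ _)); rewrite uS.
  by rewrite -{1}ru permK.
case: ifP => uS; first by rewrite restr_permE // permM permKV.
by rewrite (out_perm (restr_perm_on _ _)) ?uS.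
Qed.

(** On the orbit of [p] the exchange turns [w] into its inverse. The orbit is therefore unchanged,
    and a second exchange undoes the first. *)
Lemma swap_on_orbitK (T : finType) (p : T) : involutive (@swap_on_orbit T p).
Proof.
case=> x y; set w := (y * x^-1)%g.
case E : (swap_on_orbit p (x, y)) => [x' y'].
have sE u : x' u = (if u \in porbit w p then y u else x u) /\
            y' u = (if u \in porbit w p then x u else y u).
  by have := swap_on_orbitE _ p x y u; rewrite E.
have wV u : u \in porbit w p -> (y' * x'^-1)%g u = (w^-1)%g u.
  move=> uS; apply: (@perm_inj _ x'); rewrite permM permKV.
  rewrite (sE u).2 (sE _).1 uS -porbit_closed permKV uS.
  by rewrite invMg invgK permM permKV.
have SE : porbit (y' * x'^-1)%g p = porbit w p.
  rewrite -(porbitV w p); apply/setP => t.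
  have iterE i : ((y' * x'^-1) ^+ i)%g p = (w^-1 ^+ i)%g p.
    elim: i => [|i IH]; first by rewrite !expg0.
    by rewrite !expgSr !permM -permM IH wV // -porbitV mem_porbit.
  by apply/porbitP/porbitP => -[i ->]; exists i.
have s'E u := swap_on_orbitE _ p x' y' u; cbv zeta in s'E; rewrite SE in s'E.
have E1 : (swap_on_orbit p (x', y')).1 = x.
  by apply/permP => u; rewrite (s'E u).1 (sE u).1 (sE u).2; case: (u \in _).
have E2 : (swap_on_orbit p (x', y')).2 = y.
  by apply/permP => u; rewrite (s'E u).2 (sE u).1 (sE u).2; case: (u \in _).
by rewrite [LHS]surjective_pairing E1 E2.
Qed.

(* Bypassing v reconnects the two arcs of the cycle of y * x^-1 through a, b and v
   into two cycles, one through a and one through b. *)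
Lemma porbit_bypass (T : finType) (x y : {perm T}) (a b v : T) :
    a != b -> a != v -> b != v -> x a = v -> x v = b -> y b = v -> y v = a ->
    v \in porbit (y * x^-1)%g a ->
  a \notin porbit ((y * tperm v a) * (x * tperm v b)^-1)%g b.
Proof.
move=> ab av bv xa xv yb yv.
set y' := (y * tperm v a)%g; set x' := (x * tperm v b)%g.
set w := (y * x^-1)%g; set w' := (y' * x'^-1)%g => va.
have wb : w b = a by rewrite permM yb -xa permK.
have w'b : w' b = w v.
  apply: (@perm_inj _ x'); rewrite [w' b]permM permKV /x' /y' !permM yb yv tpermL.
  by rewrite permKV tpermD // eq_sym.
(* The bypass can alter [w] only at [b], at [v] and at the preimage of [v]. *)
have w'E u : u != b -> u != v -> w u != v -> w' u = w u.
  move=> ub uv wu; apply: (@perm_inj _ x').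
  rewrite [w' u]permM permKV /x' /y' /w !permM permKV.
  have yu_v : v != y u by rewrite -yb (inj_eq perm_inj) eq_sym.
  have yu_a : a != y u by rewrite -yv (inj_eq perm_inj) eq_sym.
  have yu_b : b != y u.
    by apply: contraNneq wu; rewrite permM => <-; rewrite -xv permK.
  by rewrite !tpermD.
clearbody w'.
have : exists n, (w ^+ n)%g v == b.
  move: va; rewrite porbit_sym => va.
  have : b \in porbit w v by rewrite -porbit_closed wb.
  by case/porbitP => n nE; exists n; rewrite nE.
clearbody w.
case/ex_minnP => n /eqP wn min_n.
have n0 : (0 < n)%N by case: n wn {min_n} => // /eqP; rewrite expg0 perm1 eq_sym (negPf bv).
have not_v i : (0 < i <= n)%N -> (w ^+ i)%g v != v.
  move=> /andP[i0 le_in]; apply/eqP => wi.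
  have /min_n : (w ^+ (n - i))%g v == b.
    by rewrite -{1}wi -permM -expgD subnKC // wn.
  by rewrite leqNgt ltn_subrL i0 n0.
(* As [n] is least, the arc from [w v] to [w^n v = b] avoids [v]. So [w'] follows [w] along it and
   then jumps from [b] back to [w v], never leaving the arc. *)
have inS k : exists2 i, (0 < i <= n)%N & (w' ^+ k)%g b = (w ^+ i)%g v.
  elim: k => [|k [i /andP[i0 le_in] IH]].
    by exists n; rewrite ?n0 ?leqnn // expg0 perm1 wn.
  rewrite expgSr permM IH.
  have [->|neq_in] := eqVneq i n.
    by exists 1%N; rewrite ?n0 // wn w'b expg1.
  have lt_in : (i < n)%N by rewrite ltn_neqAle neq_in.
  exists i.+1; first by rewrite lt_in.
  rewrite expgSr permM; apply: w'E.
  - by apply/negP => /min_n; rewrite leqNgt lt_in.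
  - by rewrite not_v // i0.
  - by rewrite -permM -expgSr not_v.
apply/negP => /porbitP[k aE].
(* Since [a = w b], meeting [a] on the arc would make [w] reach [b] before step [n]. *)
have [[//|i] /andP[_ lt_in] wi] := inS k.
have /min_n : (w ^+ i)%g v == b.
  by apply/eqP/(@perm_inj _ w); rewrite -permM -expgSr -wi -aE wb.
by rewrite leqNgt lt_in.
Qed.

(** * Cycle covers and local surgery on them *)

Lemma cycle_coverP (T : finType) (e : rel T) (s : {perm T}) :
  reflect (forall u, s u = u \/ e u (s u)) (cycle_cover e s).
Proof.
apply: (iffP forallP) => H u; first by have /orP[/eqP|] := H u; [left | right].
by apply/orP; have [->|] := H u; [left | right].
Qed.

(** Being a cover is tested one arc at a time, and loops are always allowed. *)
Lemma cycle_cover_mix (T : finType) (e : rel T) (x y s : {perm T}) :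
    cycle_cover e x -> cycle_cover e y ->
    (forall u, [\/ s u = u, s u = x u | s u = y u]) ->
  cycle_cover e s.
Proof.
move=> /cycle_coverP ex /cycle_coverP ey sP; apply/cycle_coverP => u.
by case: (sP u) => ->; [left | exact: ex | exact: ey].
Qed.

Lemma cycle_coverV (T : finType) (e : rel T) (s : {perm T}) :
  symmetric e -> cycle_cover e s -> cycle_cover e s^-1.
Proof.
move=> e_sym /cycle_coverP es; apply/cycle_coverP => u.
by have := es (s^-1 u)%g; rewrite permKV e_sym => -[/esym|]; [left | right].
Qed.

Lemma split_2cycleE (T : finType) (s : {perm T}) (p q u : T) :
    s p = q -> s q = p ->
  (s * tperm p q)%g u = if (u == p) || (u == q) then u else s u.
Proof.
move=> sp sq; rewrite permM.
have [->|up] := eqVneq u p; first by rewrite sp tpermR.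
have [->|uq] := eqVneq u q; first by rewrite sq tpermL.
have ps : p != s u by rewrite -sq (inj_eq perm_inj) eq_sym.
have qs : q != s u by rewrite -sp (inj_eq perm_inj) eq_sym.
by rewrite tpermD.
Qed.

Lemma skip_pointE (T : finType) (s : {perm T}) (a v b u : T) :
    s a = v -> s v = b ->
  (s * tperm v b)%g u = if u == v then v else if u == a then b else s u.
Proof.
move=> sa sv; rewrite permM.
have [->|uv] := eqVneq u v; first by rewrite sv tpermR.
have [->|ua] := eqVneq u a; first by rewrite sa tpermL.
have vs : v != s u by rewrite -sa (inj_eq perm_inj) eq_sym.
have bs : b != s u by rewrite -sv (inj_eq perm_inj) eq_sym.
by rewrite tpermD.
Qed.

(** * Covers classified at [v], and the uncrossing of a pair *)

(** These play the covers of G - v while remaining permutations of [T], so that surgery on covers of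
    G lands among them directly. *)
Definition covers_fixing {T : finType} (e : rel T) (v : T) : {set {perm T}} :=
  [set s | cycle_cover e s & s v == v].

Definition covers_through {T : finType} (e : rel T) (v a b : T) : {set {perm T}} :=
  [set s | cycle_cover e s & (s a == v) && (s v == b)].

Lemma card_covers_through_diag (T : finType) (e : rel T) (v a : T) :
  (#|covers_through e v a a| <= #|covers_fixing e v|)%N.
Proof.
rewrite -(card_imset _ (mulIg (tperm a v))); apply/subset_leq_card/subsetP => t.
case/imsetP => s; rewrite inE => /and3P[es /eqP sa /eqP sv] ->.
have E u := split_2cycleE _ _ _ _ u sa sv.
rewrite inE E eqxx orbT eqxx andbT; apply: (cycle_cover_mix _ _ _ _ _ es es) => u.
by rewrite E; case: ifP; [constructor 1 | constructor 2].
Qed.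

Lemma card_covers_throughC (T : finType) (e : rel T) (v a b : T) :
  symmetric e -> #|covers_through e v a b| = #|covers_through e v b a|.
Proof.
move=> e_sym.
have H c d : (#|covers_through e v c d| <= #|covers_through e v d c|)%N.
  rewrite -(card_imset _ invg_inj); apply/subset_leq_card/subsetP => t.
  case/imsetP => s; rewrite !inE => /and3P[es /eqP sc /eqP sv] ->.
  by rewrite cycle_coverV // -sv permK eqxx /= -{1}sc permK eqxx.
by apply/eqP; rewrite eqn_leq !H.
Qed.

(* If v lies on the orbit of a, v is first bypassed, at the price of the possibly
   missing edge ab; the exchange collects both of its uses into a 2-cycle (a b),
   which is then split into loops.  Whether the first component fixes a records
   the branch taken. *)
Definition uncross {T : finType} (v a b : T) (xy : {perm T} * {perm T}) :
    {perm T} * {perm T} :=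
  if v \in porbit (xy.2 * xy.1^-1)%g a then
    let s := swap_on_orbit b (xy.1 * tperm v b, xy.2 * tperm v a)%g in
    (s.1 * tperm a b, s.2)%g
  else
    let s := swap_on_orbit a xy in (s.1 * tperm b v, s.2 * tperm a v)%g.

Lemma swap_on_orbit_cases (T : finType) (p : T) (xy : {perm T} * {perm T}) u :
  ((swap_on_orbit p xy).1 u = xy.1 u \/ (swap_on_orbit p xy).1 u = xy.2 u) /\
  ((swap_on_orbit p xy).2 u = xy.1 u \/ (swap_on_orbit p xy).2 u = xy.2 u).
Proof.
case: xy => x y; have [-> ->] := swap_on_orbitE T p x y u.
by case: ifP; split; by [left | right].
Qed.

Section Uncross.

Variables (T : finType) (e : rel T) (v a b : T).
Hypotheses (ab : a != b) (av : a != v) (bv : b != v).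

Let Q := setX (covers_through e v a b) (covers_through e v b a).

(** The behaviour at [b] separates the two components into the classes whose sizes enter AM-GM. In
    both branches the second component sends [b] to [x b], which differs from [b = x v]. *)
Lemma uncross_mem (xy : {perm T} * {perm T}) : xy \in Q ->
  let fg := uncross v a b xy in
  [/\ fg.1 \in covers_fixing e v, fg.2 \in covers_fixing e v,
      fg.1 b = b, fg.2 b != b &
      (fg.1 a == a) = (v \in porbit (xy.2 * xy.1^-1)%g a)].
Proof.
have ba : b != a by rewrite eq_sym.
have va : v != a by rewrite eq_sym.
have vb : v != b by rewrite eq_sym.
case: xy => x y /setXP[] /=.
rewrite !inE => /and3P[ex /eqP xa /eqP xv] /and3P[ey /eqP yb /eqP yv].
have xb_b : x b != b by rewrite -{2}xv (inj_eq perm_inj).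
have ya_a : y a != a by rewrite -{2}yv (inj_eq perm_inj).
rewrite /uncross /=; case: ifPn => [vIn | vNot].
  (* The exchange acts at [b] but not at [a]. So the shortcuts [a -> b] and [b -> a], the only arcs
     that may not be edges, both end up in [s.1], where splitting removes them. *)
  have aNot := porbit_bypass _ _ _ _ _ _ ab av bv xa xv yb yv vIn.
  have x'E u := skip_pointE _ _ _ _ _ u xa xv.
  have y'E u := skip_pointE _ _ _ _ _ u yb yv.
  have sE := swap_on_orbitE _ b (x * tperm v b)%g (y * tperm v a)%g.
  have := swap_on_orbit_cases _ b (x * tperm v b, y * tperm v a)%g.
  move: sE; set s := swap_on_orbit _ _; cbv zeta => sE sC.
  have s1a : s.1 a = b by rewrite (sE a).1 (negPf aNot) x'E (negPf av) eqxx.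
  have s1b : s.1 b = a by rewrite (sE b).1 porbit_id y'E (negPf bv) eqxx.
  have s1v : s.1 v = v by rewrite (sE v).1 x'E y'E eqxx if_same.
  have s2v : s.2 v = v by rewrite (sE v).2 x'E y'E eqxx if_same.
  have s2b : s.2 b = x b.
    by rewrite (sE b).2 porbit_id x'E (negPf bv) (negPf ba).
  have s2a : s.2 a = y a.
    by rewrite (sE a).2 (negPf aNot) y'E (negPf av) (negPf ab).
  have fE u := split_2cycleE _ _ _ _ u s1a s1b.
  rewrite !fE !eqxx orbT (negPf va) (negPf vb) s1v s2v s2b !eqxx !andbT.
  split=> //; apply: (cycle_cover_mix _ _ _ _ _ ex ey) => u.
    rewrite fE; have [|] := boolP (_ || _); first by constructor 1.
    rewrite negb_or => /andP[/negPf ua /negPf ub].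
    have [->|/negPf uv] := eqVneq u v; first by rewrite s1v; constructor 1.
    by case: (sC u) => [[] -> _] /=; rewrite ?x'E ?y'E uv ?ua ?ub;
      [constructor 2 | constructor 3].
  have [->|/negPf uv] := eqVneq u v; first by rewrite s2v; constructor 1.
  have [->|/negPf ua] := eqVneq u a; first by rewrite s2a; constructor 3.
  have [->|/negPf ub] := eqVneq u b; first by rewrite s2b; constructor 2.
  by case: (sC u) => [_ [] ->] /=; rewrite ?x'E ?y'E uv ?ua ?ub;
    [constructor 2 | constructor 3].
have sE := swap_on_orbitE _ a x y; have sC := swap_on_orbit_cases _ a (x, y).
move: sE sC; set s := swap_on_orbit _ _; cbv zeta => sE sC.
(* The orbit contains [a] and [b] but not [v], so the exchange closes the 2-cycle (b v) in [s.1] and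
   (a v) in [s.2]. *)
have bIn : b \in porbit (y * x^-1)%g a.
  by rewrite -porbit_closed permM yb -xa permK porbit_id.
have s1v : s.1 v = b by rewrite (sE v).1 (negPf vNot).
have s1b : s.1 b = v by rewrite (sE b).1 bIn.
have s1a : s.1 a = y a by rewrite (sE a).1 porbit_id.
have s2v : s.2 v = a by rewrite (sE v).2 (negPf vNot).
have s2a : s.2 a = v by rewrite (sE a).2 porbit_id.
have s2b : s.2 b = x b by rewrite (sE b).2 bIn.
have fE u := split_2cycleE _ _ _ _ u s1b s1v.
have gE u := split_2cycleE _ _ _ _ u s2a s2v.
rewrite !fE !gE !eqxx !orbT (negPf ab) (negPf av) (negPf ba) (negPf bv) /=.
rewrite s1a s2b (negPf ya_a) !eqxx !andbT.
split=> //; apply: (cycle_cover_mix _ _ _ _ _ ex ey) => u.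
  rewrite fE; case: ifP => _; first by constructor 1.
  by case: (sC u) => [[] -> _]; [constructor 2 | constructor 3].
rewrite gE; case: ifP => _; first by constructor 1.
by case: (sC u) => [_ [] ->]; [constructor 2 | constructor 3].
Qed.

(** The output reveals the branch, by whether its first component fixes [a]. Each branch is an
    involution combined with multiplications by fixed transpositions. *)
Lemma uncross_inj : {in Q &, injective (uncross v a b)}.
Proof.
move=> [x y] [x' y'] /uncross_mem[_ _ _ _ /= c] /uncross_mem[_ _ _ _ /= c'] E.
have cc : (v \in porbit (y * x^-1)%g a) = (v \in porbit (y' * x'^-1)%g a).
  by rewrite -c -c' E.
move: E; rewrite /uncross /= -cc; case: ifP => _ [].
  move=> /mulIg E1 E2.
  have [/mulIg -> /mulIg ->] // :
      (x * tperm v b, y * tperm v a)%g = (x' * tperm v b, y' * tperm v a)%g.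
  apply: (inv_inj (@swap_on_orbitK T b)).
  by rewrite [LHS]surjective_pairing [RHS]surjective_pairing /= E1 E2.
move=> /mulIg E1 /mulIg E2; apply: (inv_inj (@swap_on_orbitK T a)).
by rewrite [LHS]surjective_pairing [RHS]surjective_pairing /= E1 E2.
Qed.

End Uncross.

(** * Counting over pairs of neighbours *)

Lemma card_covers_through_neq (T : finType) (e : rel T) (v a b : T) :
    symmetric e -> a != b -> a != v -> b != v ->
  (2 * #|covers_through e v a b| <= #|covers_fixing e v|)%N.
Proof.
move=> e_sym ab av bv; set F := covers_fixing e v.
pose Fb := [set s : {perm T} | s b == b].
have le_sqr : (#|covers_through e v a b| ^ 2 <= #|F :&: Fb| * #|F :\: Fb|)%N.
  rewrite expnS expn1 {2}card_covers_throughC // -!cardsX.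
  rewrite -(card_in_imset (@uncross_inj T e v a b ab av bv)).
  apply/subset_leq_card/subsetP => _ /imsetP[xy xyQ ->].
  have [F1 F2 b1 b2 _] := uncross_mem T e v a b ab av bv xy xyQ.
  by rewrite inE in_setI in_setD F1 F2 !inE b1 eqxx b2.
(* Squaring turns the factor 2 into the 4 of AM-GM: four times a product is at most the square of
   the sum. *)
rewrite -leq_sqr expnMn; apply: leq_trans (leq_mul (leqnn _) le_sqr) _.
by rewrite -(cardsID Fb F) nat_AGM2.
Qed.

Lemma covers_through_neq0 (T : finType) (e : rel T) (v a b : T) :
    symmetric e -> b != v ->
  covers_through e v a b != set0 -> [/\ a != v, e v a & e v b].
Proof.
move=> e_sym bv /set0Pn[s]; rewrite inE => /and3P[/cycle_coverP es /eqP sa /eqP sv].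
have av : a != v by apply: contraNneq bv => av; rewrite -sv -{1}av sa.
split=> //.
  by have := es a; rewrite sa e_sym => -[/eqP|//]; rewrite eq_sym (negPf av).
by have := es v; rewrite sv => -[/eqP|//]; rewrite (negPf bv).
Qed.

Lemma card_covers_bound (T : finType) (e : rel T) (v : T) :
  symmetric e ->
  (2 * C e <= (2 + deg e v * (deg e v).-1) * #|covers_fixing e v|)%N.
Proof.
move=> e_sym; rewrite /deg /=; set N := [set u | _]; set F := covers_fixing e v.
have Cdecomp : (C e <= #|F| + \sum_(b in N) \sum_(a in N) #|covers_through e v a b|)%N.
  rewrite /C -(cardsID [set s : {perm T} | s v == v]) leq_add //.
    by apply/subset_leq_card/subsetP => s; rewrite !inE.
  pose Q b a := covers_through e v a b.
  apply: (@leq_trans #|\bigcup_(b in N) \bigcup_(a in N) Q b a|).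
    apply/subset_leq_card/subsetP => s; rewrite !inE => /andP[svv es].
    have sQ : s \in Q (s v) (s^-1 v)%g by rewrite inE es permKV !eqxx.
    have [|av ea eb] := covers_through_neq0 _ e v (s^-1 v)%g (s v) e_sym svv.
      by apply/set0Pn; exists s.
    apply/bigcupP; exists (s v); first by rewrite inE svv.
    by apply/bigcupP; exists (s^-1 v)%g; first by rewrite inE av.
  have cardU (I : {set T}) (G : T -> {set {perm T}}) :
      (#|\bigcup_(i in I) G i| <= \sum_(i in I) #|G i|)%N.
    elim/big_rec2: _ => [|i m U _ le_m]; first by rewrite cards0.
    by apply: leq_trans (leq_card_setU _ _) _; rewrite leq_add2l.
  by apply: leq_trans (cardU _ _) _; apply: leq_sum => b _; exact: cardU.
(* After doubling, the diagonal term [a = b] costs at most 2 [#|F|] and each of the other [#|N| - 1]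
   terms at most [#|F|]. *)
have inner b : b \in N ->
    (2 * \sum_(a in N) #|covers_through e v a b| <= #|N|.+1 * #|F|)%N.
  move=> bN; rewrite (bigD1 b) //= mulnDr big_distrr /=.
  have : (\sum_(a in N | a != b) 2 * #|covers_through e v a b| <=
          \sum_(a in N | a != b) #|F|)%N.
    apply: leq_sum => a /andP[aN ab]; apply: card_covers_through_neq => //.
      by move: aN; rewrite inE => /andP[].
    by move: bN; rewrite inE => /andP[].
  rewrite sum_nat_const.
  have -> : #|[pred a in N | a != b]| = #|N :\ b|.
    by apply: eq_card => u; rewrite !inE andbC.
  rewrite (cardsD1 b N) bN => le_sum.
  have -> : ((true + #|N :\ b|).+1 * #|F| = 2 * #|F| + #|N :\ b| * #|F|)%N.
    by rewrite -mulnDl.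
  by apply: leq_add => //; rewrite leq_mul2l card_covers_through_diag.
have : (2 * \sum_(b in N) \sum_(a in N) #|covers_through e v a b|
        <= #|N| * (#|N|.+1 * #|F|))%N.
  by rewrite big_distrr /= -sum_nat_const; apply: leq_sum.
move=> le_sum; apply: leq_trans (leq_mul (leqnn 2) Cdecomp) _.
by rewrite mulnDr [leqRHS]mulnDl leq_add2l -mulnA mulnCA.
Qed.

(** * Passage to G - v and the final estimate *)

Lemma card_covers_fixing (T : finType) (e : rel T) (v : T) :
  (#|covers_fixing e v| <= C (del_rel e v))%N.
Proof.
(* The default [x] of [insubd] never occurs when [s] fixes [v]. For other [s] the map [r s] may fail
   to be injective, hence functions as values. *)
pose r (s : {perm T}) : {ffun del_vertex v -> del_vertex v} :=
  [ffun x => insubd x (s (val x))].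
have rE (s : {perm T}) x : s v = v -> val (r s x) = s (val x).
  move=> sv; rewrite ffunE val_insubd ifT // -[X in _ != X]sv (inj_eq perm_inj).
  exact: (valP x).
have r_inj : {in covers_fixing e v &, injective r}.
  move=> s t; rewrite !inE => /andP[_ /eqP sv] /andP[_ /eqP tv] rst.
  apply/permP => u; have [->|uv] := eqVneq u v; first by rewrite sv tv.
  by rewrite -[u]/(val (Sub u uv : del_vertex v)) -!rE // rst.
(* Both sets are compared as sets of functions, the covers of G - v through [val]. *)
rewrite /C -(card_in_imset r_inj) -(card_imset _ (@val_inj _ _ {perm del_vertex v})).
apply/subset_leq_card/subsetP => _ /imsetP[s sF ->].
move: sF; rewrite inE => /andP[/cycle_coverP es /eqP sv].
have inj_r : injective (r s).
  by move=> x y /(congr1 val); rewrite !rE // => /perm_inj/val_inj.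
apply/imsetP; exists (perm inj_r).
  rewrite inE; apply/cycle_coverP => x; rewrite permE /del_rel rE //.
  by have [sx|] := es (val x); [left; apply: val_inj; rewrite rE | right].
by apply/ffunP => x; rewrite -[LHS](permE inj_r) -pvalE.
Qed.

Theorem theorem2p1 (T : finType) (e : rel T) (e_sym : symmetric e) (v : T) :
  (C e)%:R / (C (del_rel e v))%:R
    <= 1 + ((deg e v)%:R ^+ 2 - (deg e v)%:R) / 2 :> rat.
Proof.
have C_gt0 : (0 < C (del_rel e v))%N.
  by apply/card_gt0P; exists 1%g; rewrite inE; apply/cycle_coverP => u; left; rewrite perm1.
have le_nat : (2 * C e <= (2 + deg e v * (deg e v).-1) * C (del_rel e v))%N.
  by apply: leq_trans (card_covers_bound _ e v e_sym) _; rewrite leq_mul2l card_covers_fixing orbT.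
rewrite ler_pdivrMr ?ltr0n //.
move: le_nat; rewrite -(ler_nat rat) !natrM natrD natrM.
(* The predecessor is not truncated here, [deg] being a successor. *)
have -> : (deg e v).-1%:R = (deg e v)%:R - 1 :> rat by rewrite /deg /= -natr1 addrK.
set d := (deg e v)%:R; set c := (C _)%:R; set c' := (C (del_rel e v))%:R => le_c.
lra.
Qed.
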